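(* Let $K$ be an arbitrary field of characteristic different from $2$. Assume that the identity $(x^2)^2=0$ holds in a commutative algebra $A$ over $K$. Then the following conditions are equivalent: (i) $A$ is a nil-algebra of bounded nil-index; (ii) $A$ is Engel; (iii) $A$ is Yagzhev.
   Context: Algebras are not assumed associative, unital or finite-dimensional. Principal powers: $x^1=x$, $x^{k+1}=x^kx$. $A$ is a nil-algebra of bounded nil-index if there is $n$ with $x^n=0$ for all $x\in A$. $A$ is Engel if there is $p>0$ such that $L_x^p(y)=0$ for all $x,y\in A$, where $L_x(y)=xy$. For $q\ge1$, $T_q(x)$ denotes the sum of all products of $q$ copies of $x$ over all arrangements of parentheses (i.e. the sum of all multilinear multiple compositions of the multiplication with $q$ arguments, all arguments set equal to $x$); so $T_1(x)=x$ and $T_q(x)=\sum_{i=1}^{q-1}T_i(x)T_{q-i}(x)$ for $q\ge 2$. $A$ is weakly nilpotent, or Yagzhev, if there is $q_0>0$ such that $T_q(x)=0$ for all $x\in A$ and all $q\ge q_0$. *)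

(* Defs.v *)
From HB Require Import structures.
From mathcomp Require Import all_boot all_order all_algebra.

Set Implicit Arguments.
Unset Strict Implicit.
Unset Printing Implicit Defensive.

Import GRing.Theory.
Local Open Scope ring_scope.

(* A nonassociative algebra over K is a left K-module A with a K-bilinear
   multiplication mul : {bilinear A -> A -> A}; the rings of MathComp are
   associative, so lalgType and algType do not apply. *)

Inductive bracketing : Type :=
| Arg
| Mul of bracketing & bracketing.

Fixpoint tree_of_bracketing (t : bracketing) : GenTree.tree unit :=
  match t with
  | Arg => GenTree.Leaf tt
  | Mul l r => GenTree.Node 0 [:: tree_of_bracketing l; tree_of_bracketing r]
  end.

Fixpoint bracketing_of_tree (t : GenTree.tree unit) : bracketing :=
  match t with
  | GenTree.Node 0 [:: l; r] => Mul (bracketing_of_tree l) (bracketing_of_tree r)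
  | _ => Arg
  end.

Lemma tree_of_bracketingK : cancel tree_of_bracketing bracketing_of_tree.
Proof. by elim=> //= l -> r ->. Qed.

HB.instance Definition _ := Equality.copy bracketing (can_type tree_of_bracketingK).

Fixpoint arity (t : bracketing) : nat :=
  if t is Mul l r then (arity l + arity r)%N else 1.

Lemma arity_gt0 t : (0 < arity t)%N.
Proof. by elim: t => //= l lP r rP; rewrite addn_gt0 lP. Qed.

(* d bounds the recursion depth; d = q is enough, see mem_bracketings. *)
Fixpoint bracketings_rec (d q : nat) : seq bracketing :=
  if d is d'.+1 then
    if q == 1%N then [:: Arg] else
    flatten [seq [seq Mul l r | l <- bracketings_rec d' i,
                                r <- bracketings_rec d' (q - i)]
            | i <- index_iota 1 q]
  else [::].

Definition bracketings (q : nat) : seq bracketing := bracketings_rec q q.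

Fact split_bound d q i : (q <= d.+1)%N -> (0 < i < q)%N ->
  (i <= d)%N /\ (q - i <= d)%N.
Proof.
move=> leqd /andP[i_gt0 ltiq]; split; first by rewrite -ltnS (leq_trans ltiq).
by rewrite leq_subLR (leq_trans leqd)// -add1n leq_add2r.
Qed.

Lemma mem_bracketings_rec d q t : (q <= d)%N ->
  (t \in bracketings_rec d q) = (arity t == q).
Proof.
elim: d q t => [|d IHd] q t.
  by rewrite leqn0 => /eqP->; rewrite eqn0Ngt arity_gt0.
move=> leqd /=; have [->|qn1] := eqVneq q 1%N.
  rewrite inE; case: t => //= l r.
  have := arity_gt0 l; have := arity_gt0 r.
  by case: (arity l) (arity r) => [|m] [|n] // _ _; rewrite addSn addnS.
apply/flatten_mapP/eqP => [[i]|tq].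
  rewrite mem_index_iota => iq /allpairsP[[l r] /= [+ + ->]] /=.
  have [leid leqid] := split_bound leqd iq.
  rewrite !IHd// => /eqP-> /eqP->.
  by rewrite subnKC// ltnW//; case/andP: iq.
case: t tq => [/esym/eqP|l r /= tq]; first by rewrite (negPf qn1).
have iq : (0 < arity l < q)%N.
  by rewrite arity_gt0 -tq -[X in (X < _)%N]addn0 ltn_add2l arity_gt0.
have [leid leqid] := split_bound leqd iq.
exists (arity l); first by rewrite mem_index_iota.
by apply: allpairs_f; rewrite IHd// -tq addKn.
Qed.

Lemma mem_bracketings q t : (t \in bracketings q) = (arity t == q).
Proof. exact: mem_bracketings_rec. Qed.

Lemma bracketings_rec_uniq d q : (q <= d)%N -> uniq (bracketings_rec d q).
Proof.
elim: d q => [|d IHd] q leqd //=; case: ifP => // _.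
set F := fun i => allpairs _ _ _.
have -> : flatten [seq F i | i <- index_iota 1 q] =
    [seq x | i <- index_iota 1 q, x <- F i].
  by congr flatten; apply: eq_map => i; rewrite map_id.
apply: allpairs_uniq_dep; first exact: iota_uniq.
  move=> i; rewrite mem_index_iota => /(split_bound leqd)[leid leqid].
  by apply: allpairs_uniq; rewrite ?IHd// => -[a b] [a' b'] _ _ /= [-> ->].
have tagE p :
    p \in [seq existT (fun=> bracketing) i y | i <- index_iota 1 q, y <- F i] ->
    if tagged p is Mul l _ then arity l = tag p else False.
  case/allpairsPdep => i [x [+ + ->]] /=.
  rewrite mem_index_iota => /(split_bound leqd)[leid _].
  by case/allpairsP=> -[l r] /= [+ _ ->]; rewrite (mem_bracketings_rec _ leid) => /eqP.
move=> [i x] [j y] /tagE /= + /tagE /= + /= xy.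
by rewrite -{y}xy; case: x => // l r -> ->.
Qed.

Lemma bracketings_uniq q : uniq (bracketings q).
Proof. exact: bracketings_rec_uniq. Qed.

Section PowersAndPredicates.
Variables (A : zmodType) (mul : A -> A -> A).

(* x^k for k >= 1; the value at k = 0 is a junk value. *)
Definition ppow (x : A) (k : nat) : A := iter k.-1 (fun z => mul z x) x.

Fixpoint beval (x : A) (t : bracketing) : A :=
  if t is Mul l r then mul (beval x l) (beval x r) else x.

Definition Tsum (q : nat) (x : A) : A := \sum_(t <- bracketings q) beval x t.

Definition nil_bounded_index : Prop :=
  exists2 n : nat, (0 < n)%N & forall x : A, ppow x n = 0.

Definition Engel : Prop :=
  exists2 p : nat, (0 < p)%N & forall x y : A, iter p (mul x) y = 0.

Definition Yagzhev : Prop :=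
  exists2 q0 : nat, (0 < q0)%N &
    forall (q : nat) (x : A), (q0 <= q)%N -> Tsum q x = 0.

Lemma ppow1 x : ppow x 1 = x. Proof. by []. Qed.

Lemma ppowS x k : (0 < k)%N -> ppow x k.+1 = mul (ppow x k) x.
Proof. by case: k. Qed.

Lemma Tsum1 x : Tsum 1 x = x.
Proof. by rewrite /Tsum big_seq1. Qed.

End PowersAndPredicates.

Lemma TsumE (K : fieldType) (A : lmodType K) (mul : {bilinear A -> A -> A})
    (q : nat) (x : A) : (2 <= q)%N ->
  Tsum mul q x = \sum_(1 <= i < q) mul (Tsum mul i x) (Tsum mul (q - i) x).
Proof.
case: q => [//|d] d_gt0; rewrite /Tsum {1}/bracketings /= eqSS.
rewrite (negPf (lt0n_neq0 d_gt0)) big_flatten big_map.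
have bE i : (i <= d)%N -> perm_eq (bracketings_rec d i) (bracketings i).
  move=> leid; apply: uniq_perm; rewrite ?bracketings_uniq ?bracketings_rec_uniq//.
  by move=> t; rewrite mem_bracketings mem_bracketings_rec.
apply: eq_big_nat => i iq; have [leid leqid] := split_bound (leqnn _) iq.
rewrite big_allpairs_dep /= (perm_big _ (bE _ leid)) linear_sumlz /=.
apply: eq_bigr => l _; rewrite (perm_big _ (bE _ leqid)) linear_sumr /=.
by [].
Qed.

(* Main.v *)
(* With [T = sum_q T_q(x)] and [Q = T^2 = T - x], the identity [Q^2 = 0] reads
   [T - x = 2 x T - x^2] and gives [T_q(x) = 2^(q-2) x^q] for [q >= 2], so that
   Yagzhev and nil of bounded index are the same, and Engel implies nil since
   [x^(p+1) = L_x^p x].  For nil implies Engel, let [x^n = 0] for all [x].  The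
   polarised identity [x^2 (y z) = -2 (x y)(x z)] has three consequences.
   If [z^2 = 0] then [(z + z y)^k = 2 L_z^k y]; hence [L_(x^2)] is nilpotent.
   As [(L_x^m u)(L_x^m v)] is a multiple of [L_(x^2)^m (u v)], it vanishes for
   [m >= n].  Finally [x^j (L_x^m y) = 0] for [2 <= j <= m].  Therefore
   [(x + w)^n = x^n + 2 L_x^(n-1) w] for [w = L_x^m y], that is,
   [L_x^(n-1+m) y = 0]. *)
Require Import Defs.
From mathcomp Require Import all_boot all_order all_algebra.

Import GRing.Theory.
Local Open Scope ring_scope.

Section SquareOfSquareZero.
Variables (K : fieldType) (A : lmodType K) (mul : {bilinear A -> A -> A}).
Hypothesis charK : 2%N \notin [pchar K].
Hypothesis mulC : commutative mul.
Hypothesis sqr_sqr0 : forall x : A, ppow mul (ppow mul x 2) 2 = 0.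

Local Notation "x '**' y" := (mul x y) (at level 40, left associativity).
Local Notation sq x := (mul x x).

Implicit Types a b u v w x y z : A.

Lemma mulr2n_eq0_char u : u *+ 2 = 0 -> u = 0.
Proof.
rewrite -scaler_nat => /eqP; rewrite scaler_eq0 => /orP[/eqP two0|/eqP//].
by case/negP: charK; rewrite inE /= two0 eqxx.
Qed.

Lemma addr_subr_eq0 u v : u + v = 0 -> u - v = 0 -> u = 0 /\ v = 0.
Proof.
move=> /eqP; rewrite addr_eq0 => /eqP-> /eqP.
rewrite -opprD oppr_eq0 -mulr2n => /eqP/mulr2n_eq0_char ->.
by rewrite oppr0.
Qed.

Let mulDl u v w : (u + v) ** w = u ** w + v ** w.
Proof. exact: linearDl. Qed.

Let mulDr u v w : u ** (v + w) = u ** v + u ** w.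
Proof. exact: linearDr. Qed.

Let mulNl u v : (- u) ** v = - (u ** v).
Proof. exact: linearNl. Qed.

Let mulNr u v : u ** (- v) = - (u ** v).
Proof. exact: linearNr. Qed.

Let mulMnl u v n : (u *+ n) ** v = (u ** v) *+ n.
Proof. exact: linearMnl. Qed.

Let mulMnr u v n : u ** (v *+ n) = (u ** v) *+ n.
Proof. exact: linearMnr. Qed.

Let mul0l u : 0 ** u = 0.
Proof. exact: linear0l. Qed.

Let mul0r u : u ** 0 = 0.
Proof. exact: linear0r. Qed.

(** * Linearisations of [(x^2)^2 = 0] *)

Lemma sqD u v : sq (u + v) = sq u + sq v + (u ** v) *+ 2.
Proof.
rewrite mulDl !mulDr (mulC v u) mulr2n.
by rewrite [LHS](AC (2*2) (1*4*(2*3))).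
Qed.

Lemma sqN u : sq (- u) = sq u.
Proof. by rewrite mulNl mulNr opprK. Qed.

Lemma sqMn u n : sq (u *+ n) = sq u *+ (n * n).
Proof. by rewrite mulMnl mulMnr -mulrnA. Qed.

Lemma sq_sq x : sq (sq x) = 0. Proof. exact: sqr_sqr0. Qed.

(* The components of [(x + y)^2 (x + y)^2 = 0] that are odd and even in [y]; the
   components of degrees 1 and 3 cannot be separated over the field with three
   elements. *)
Lemma sq_sq_components x y :
  (sq x + sq y) ** (x ** y) = 0 /\ sq x ** sq y + sq (x ** y) *+ 2 = 0.
Proof.
set s := sq x + sq y; set p := x ** y.
have sqp : sq s + sq (p *+ 2) + s ** (p *+ 2) *+ 2 = 0.
  by rewrite -sqD -sqD sq_sq.
have sqm : sq s + sq (p *+ 2) - s ** (p *+ 2) *+ 2 = 0.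
  have := sq_sq (x - y).
  by rewrite sqD sqN mulNr mulNrn -/s -/p sqD sqN mulNr mulNrn.
have [even0 odd0] := addr_subr_eq0 _ _ sqp sqm.
split; first by apply/mulr2n_eq0_char/mulr2n_eq0_char; rewrite -mulMnr.
move: even0; rewrite sqD !sq_sq !add0r sqMn (mulrnA _ 2 2) -mulrnDl.
exact: mulr2n_eq0_char.
Qed.

Lemma sq_odd x y : sq x ** (x ** y) = - (sq y ** (y ** x)).
Proof.
apply/eqP; rewrite -addr_eq0 (mulC y x) -mulDl.
by case: (sq_sq_components x y) => ->.
Qed.

Lemma sq_even x y : sq x ** sq y = - (sq (x ** y) *+ 2).
Proof.
by apply/eqP; rewrite -addr_eq0; case: (sq_sq_components x y) => _ ->.
Qed.

Lemma sq_mul x y z : sq x ** (y ** z) = - ((x ** y) ** (x ** z) *+ 2).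
Proof.
apply/eqP; rewrite -addr_eq0; apply/eqP/mulr2n_eq0_char.
have := sq_even x (y + z).
rewrite sqD (mulDr x) sqD mulDr mulMnr mulDr !sq_even.
by rewrite -opprD !mulrnDl [X in _ = X -> _]opprD => /addrI ->; rewrite addNr.
Qed.

(** Full linearisation: polarise [sq_mul] in [x] and cancel 2. *)
Lemma mul_mul x y z w :
  (x ** y) ** (z ** w) + (x ** z) ** (y ** w) + (x ** w) ** (y ** z) = 0.
Proof.
have := sq_mul (x + y) z w.
rewrite sqD (mulDl _ (_ *+ 2)) mulMnl (mulDl (sq x)) !(mulDl x) mulDl.
rewrite !mulDr !sq_mul (mulC (y ** z) (x ** w)) [_ + y ** z ** (y ** w)]addrC.
rewrite (addrACA (x ** z ** (x ** w))) -opprD -mulrnDl => /eqP.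
rewrite [_ + _ *+ 2]addrC subr_eq [_ *- 2 + _]addrC -mulrnBl.
rewrite opprD addrA subrr add0r => /eqP E.
by apply: mulr2n_eq0_char; rewrite -addrA mulrnDl E -mulrnDl addNr mul0rn.
Qed.

(* Away from characteristic 3 already [x^2 (x y) = 0]. In general the proof
   compares [fmul] below at [c], [c + d] and at [d], [- d]. *)
Lemma sq_mul_mul x a b : sq x ** (x ** (a ** b)) = 0.
Proof.
pose f u v := sq u ** (u ** v).
have fC u v : f u v = - f v u by exact: sq_odd.
have fDr u v y : f u (v + y) = f u v + f u y by rewrite /f !mulDr.
have fDl u v y : f (u + v) y = f u y + f v y.
  by rewrite fC fDr opprD -!fC.
have fN u v : f u (- v) = - f u v by rewrite /f !mulNr.
have fxx u : f u u = 0 by exact: sq_sq.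
(* [sq_odd] and [sq_even] turn the left side into [(sq c ** sq d) ** ((c ** d) ** u)], to which
   [mul_mul] applies. *)
have fmul u c d : f u (c ** d) *+ 2 = f c d ** (sq c ** u - sq d ** u).
  rewrite /f sq_odd mulNrn -mulMnl -mulNl -sq_even.
  have := mul_mul (sq c) (sq d) (c ** d) u.
  rewrite -/(f c d) (mulC c d) -/(f d c) -addrA => /eqP.
  rewrite addr_eq0 => /eqP ->.
  by rewrite (mulC _ (f d c)) (fC d) mulNl opprD opprK addrC mulDr mulNr.
have fsq u c : f u (sq c) = 0 by rewrite fC /f sq_sq mul0l oppr0.
have fsqD u c d : - (f c d ** (sq d ** u)) = (f c d ** ((c ** d) ** u)) *+ 2.
  have := fmul u (c + d) d; rewrite (mulDl c) fDr fsq addr0 fmul.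
  rewrite fDl fxx addr0 sqD (addrAC (sq c)) (mulDl _ (sq d)) addrK.
  by rewrite (mulDl (sq c)) !(mulDr (f c d)) mulMnl mulMnr mulNr => /addrI.
(* Replacing [d] by [- d] in [fsqD] changes the sign of the left side only. *)
have fsqr u c d : f c d ** (sq d ** u) = 0.
  apply: mulr2n_eq0_char; have := fsqD u c (- d).
  rewrite fN sqN !mulNr !mulNl mulNr !opprK -fsqD => /eqP.
  by rewrite -addr_eq0 -mulr2n => /eqP.
apply: mulr2n_eq0_char; rewrite -/(f _ _) fmul mulDr mulNr fsqr subr0.
by rewrite fC mulNl fsqr oppr0.
Qed.

(** * Principal powers and the sums [T_q] *)

Local Notation "x ^^ k" := (ppow mul x k) (at level 30).

Lemma mul_ppow x k : (0 < k)%N -> x ** (x ^^ k) = x ^^ k.+1.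
Proof. by move=> k_gt0; rewrite mulC ppowS. Qed.

Lemma ppow_iter x k : x ^^ k.+1 = iter k (mul x) x.
Proof. by elim: k => // k IHk; rewrite ppowS //= IHk mulC. Qed.

Lemma ppow_eq0_le x m n : (0 < m <= n)%N -> x ^^ m = 0 -> x ^^ n = 0.
Proof.
case/andP=> m_gt0 /subnK <- xm0; elim: (n - m)%N => // k IHk.
by rewrite addSn ppowS ?addn_gt0 ?m_gt0 ?orbT // IHk mul0l.
Qed.

Lemma sq_mul_ppow x k : sq x ** x ^^ k.+2 = 0.
Proof.
case: k => [|k]; first exact: sq_sq.
by rewrite -mul_ppow // ppowS // sq_mul_mul.
Qed.

(** With [P] the formal sum of all [x ^^ k], [k >= 1], these are the components of degree [n + 2] of
    [P^2] and of degree [n + 4] of [(P - x)^2]. *)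
Let conv x n := \sum_(i < n.+1) x ^^ i.+1 ** x ^^ (n - i).+1.
Let conv2 x n := \sum_(i < n.+1) x ^^ i.+2 ** x ^^ (n - i).+2.

(** By [sq_mul], multiplying [conv x n] by [sq x] raises all exponents by one, up to the factor -2.
    Without its end terms, which [sq x] kills, [conv x n] is [conv2 x (n - 2)], zero by
    induction. *)
Lemma conv2_eq0 x n : conv2 x n = 0.
Proof.
have convSS m : conv x m.+2 = x ^^ m.+4 *+ 2 + conv2 x m.
  rewrite /conv big_ord_recl big_ord_recr /= subn0 subnn mul_ppow //.
  rewrite -ppowS // mulr2n addrA addrAC; congr (_ + _).
  by apply: eq_bigr => i _; rewrite /bump /= add1n subSS subSn // -ltnS.
have sq_conv m : sq x ** conv x m = - (conv2 x m *+ 2).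
  rewrite /conv /conv2 (big_morph _ (mulDr (sq x)) (mul0r _)).
  rewrite -sumrMnl -sumrN; apply: eq_bigr => i _.
  by rewrite sq_mul !mul_ppow.
suff sq_conv0 : sq x ** conv x n = 0.
  by apply: mulr2n_eq0_char; apply/eqP; rewrite -oppr_eq0 -sq_conv sq_conv0.
elim/ltn_ind: n => -[|[|n]] IHn.
- by rewrite /conv big_ord1 sq_sq.
- rewrite /conv 2!big_ord_recl big_ord0 addr0 mulDr /= mul_ppow //.
  by rewrite -ppowS // sq_mul_ppow addr0.
have conv20 : conv2 x n = 0.
  by apply: mulr2n_eq0_char; apply/eqP; rewrite -oppr_eq0 -sq_conv IHn.
by rewrite convSS conv20 addr0 mulMnr sq_mul_ppow mul0rn.
Qed.

(** In the recursion for [T_q] the two end terms agree, whence the doubling; the inner terms add up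
    to a multiple of [conv2]. *)
Lemma Tsum_ppow x n : Tsum mul n.+2 x = x ^^ n.+2 *+ 2 ^ n.
Proof.
have TsumSS m : Tsum mul m.+2 x =
    \sum_(i < m.+1) Tsum mul i.+1 x ** Tsum mul (m - i).+1 x.
  rewrite TsumE // big_add1 big_mkord; apply: eq_bigr => i _.
  by rewrite subSS subSn // -ltnS.
elim/ltn_ind: n => -[|[|n]] IHn; rewrite TsumSS.
- by rewrite big_ord1 Tsum1.
- rewrite 2!big_ord_recl big_ord0 /= Tsum1 IHn //= mul_ppow //.
  by rewrite addr0 -ppowS.
rewrite big_ord_recl big_ord_recr /= subn0 subnn Tsum1 IHn // mulMnr mulMnl.
rewrite mul_ppow // -ppowS // [X in _ + (X + _)](_ : _ = conv2 x n *+ 2 ^ n).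
  by rewrite conv2_eq0 mul0rn add0r -mulrnDr addnn -mul2n -expnS.
rewrite -sumrMnl; apply: eq_bigr => i _.
have lein : (i <= n)%N by rewrite -ltnS.
rewrite /bump /= add1n subSS subSn // (IHn i) ?(IHn (n - i)%N); first 1 last.
- by rewrite ltnS (leq_trans (leq_subr _ _)).
- by rewrite ltnS leqW.
by rewrite mulMnl mulMnr -mulrnA -expnD subnK.
Qed.

(** * Iterated left multiplications *)

Let iterMn k x u n : iter k (mul x) (u *+ n) = iter k (mul x) u *+ n.
Proof. by elim: k => //= k ->; rewrite mulMnr. Qed.

Let iterN k x u : iter k (mul x) (- u) = - iter k (mul x) u.
Proof. by elim: k => //= k ->; rewrite mulNr. Qed.

(** By [sq_mul], [sq z = 0] kills every product of two multiples of [z], so [z + z ** y] acts on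
    such multiples as [z] alone. *)
Lemma ppow_sq0_add z y k : sq z = 0 ->
  (z + z ** y) ^^ k.+2 = iter k.+2 (mul z) y *+ 2.
Proof.
move=> z0.
have zz0 u v : (z ** u) ** (z ** v) = 0.
  by apply: mulr2n_eq0_char; apply: oppr_inj; rewrite -sq_mul z0 mul0l oppr0.
elim: k => [|k IHk]; first by rewrite [LHS]sqD z0 zz0 !add0r.
by rewrite ppowS // IHk mulMnl mulDr /= zz0 addr0 mulC.
Qed.

Lemma iter_mul_mul m x u v : iter m (mul (sq x)) (u ** v) = 0 ->
  iter m (mul x) u ** iter m (mul x) v = 0.
Proof.
elim: m u v => // m IHm u v; rewrite iterSr sq_mul iterN iterMn => /eqP.
rewrite oppr_eq0 => /eqP/mulr2n_eq0_char/IHm.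
by rewrite -!iterSr.
Qed.

(** Each use of [sq_mul] lowers the power by one and strips one [L_x], down to [sq_mul_mul]; hence
    the bound on [k]. *)
Lemma ppow_mul_iter x y k m : (k.+1 < m)%N -> x ^^ k.+2 ** iter m (mul x) y = 0.
Proof.
move=> /subnK <-; rewrite addnC iterD; elim: k {y}(iter _ _ y) => [|k IHk] y.
  by rewrite /= sq_mul_mul.
apply/mulr2n_eq0_char/oppr_inj.
by rewrite -(mul_ppow _ k.+2) // -sq_mul IHk mul0r oppr0.
Qed.

(* For directions of the form [L_x^m y] a power of [x + L_x^m y] is its own
   linearisation; this replaces the polarisation of [x^n = 0], which is not
   available over a small finite field. *)
Lemma ppow_add_iter m x y k : (k < m)%N ->
    (forall u v, iter m (mul x) u ** iter m (mul x) v = 0) ->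
  (x + iter m (mul x) y) ^^ k.+2 =
    x ^^ k.+2 + iter (k.+1 + m) (mul x) y *+ 2.
Proof.
move=> + mm0; elim: k => [|k IHk] km.
  by rewrite [LHS]sqD mm0 addr0.
rewrite ppowS // IHk ?(ltnW km) // mulDl !mulDr -ppowS //.
rewrite ppow_mul_iter // addr0 !mulMnl [X in _ + (_ + X)](_ : _ = 0).
  by rewrite addr0 mulC.
by rewrite addnC iterD mm0 mul0rn.
Qed.

(** * The implications between the three conditions *)

Lemma nil_Engel : nil_bounded_index mul -> Engel mul.
Proof.
case=> n n_gt0 nil; have {}nil k x : (n <= k)%N -> x ^^ k = 0.
  by move=> lenk; apply: ppow_eq0_le (nil x); rewrite n_gt0.
have mm0 x u v : iter n.+2 (mul x) u ** iter n.+2 (mul x) v = 0.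
  apply: iter_mul_mul; apply: mulr2n_eq0_char.
  (* Here [z = sq x], so that [L_(x^2)^(n+2) = 0]. *)
  by rewrite -ppow_sq0_add ?nil ?sq_sq // !leqW.
(* [n + 2] factors make the products in [mm0] vanish; the power [n + 2] of [x + L_x^(n+2) y]
   contributes [n + 1] more. *)
exists (n.+1 + n.+2)%N => // x y; apply: mulr2n_eq0_char.
have := ppow_add_iter n.+2 x y n (leqnSn n.+1) (mm0 x).
by rewrite !nil ?leqW // add0r => <-.
Qed.

Lemma Engel_nil : Engel mul -> nil_bounded_index mul.
Proof. by case=> p _ engel; exists p.+1 => // x; rewrite ppow_iter engel. Qed.

Lemma nil_Yagzhev : nil_bounded_index mul -> Yagzhev mul.
Proof.
case=> n n_gt0 nil; exists n.+2 => // -[|[|q]] x // lenq.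
rewrite Tsum_ppow (ppow_eq0_le x n q.+2 _ (nil x)) ?mul0rn //.
by rewrite n_gt0 ltnW // ltnW.
Qed.

Lemma Yagzhev_nil : Yagzhev mul -> nil_bounded_index mul.
Proof.
case=> q0 _ yagzhev; exists q0.+2 => // x.
have := yagzhev q0.+2 x (leqW (leqnSn _)); rewrite Tsum_ppow.
elim: q0 {yagzhev} (x ^^ q0.+2) => [|k IHk] u; rewrite ?expn0 //.
by rewrite expnS mulrnA => /IHk/mulr2n_eq0_char.
Qed.

End SquareOfSquareZero.

Theorem theorem8p4 (K : fieldType) (A : lmodType K)
    (mul : {bilinear A -> A -> A})
    (charK : 2%N \notin [pchar K])
    (mulC : commutative mul)
    (sqr_sqr0 : forall x : A, ppow mul (ppow mul x 2) 2 = 0) :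
  (nil_bounded_index mul <-> Engel mul) /\ (Engel mul <-> Yagzhev mul).
Proof.
have nilE := @nil_Engel K A mul charK mulC sqr_sqr0.
have Enil := @Engel_nil K A mul mulC.
split; split=> //.
  by move/Enil; apply: nil_Yagzhev.
by move=> yagzhev; apply/nilE/Yagzhev_nil.
Qed.
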